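(* Let $X$ be a real Banach space with dual $X^*$ and let $D$ be a bounded closed convex subset of $X$. Let $\epsilon>0$ and $\delta>0$ be given. If $f\in X^*$ and $x_0\in D$ satisfy $$f(x_0)>\sup\{f(x):x\in D\}-\frac{\delta}{2},$$ then there exist $g\in X^*$ and $x_1\in D$ such that $$g(x_1)=\sup\{g(x):x\in D\},\qquad \|f-g\|\leq\epsilon,\qquad \|x_1-x_0\|\leq\frac{\delta}{\epsilon}.$$
   Context: All Banach spaces are over $\mathbb{R}$. $X^*$ carries the usual dual norm. *)

(* Defs.v *)
From HB Require Import structures.
From mathcomp Require Import all_boot all_order all_algebra.
From mathcomp Require Import all_classical all_reals all_analysis.

Set Implicit Arguments.
Unset Strict Implicit.
Unset Printing Implicit Defensive.

Import Order.TTheory GRing.Theory Num.Theory.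
Import numFieldNormedType.Exports.

Local Open Scope classical_set_scope.
Local Open Scope ring_scope.

(* [sup] returns the default value 0 on a set with no upper bound, so this is
   the dual norm only for continuous [h]; the topological dual is rendered as
   the [h : {linear X -> R^o}] such that [continuous h]. *)
Definition dual_norm (R : realType) (X : normedModType R)
    (h : {linear X -> R^o}) : R :=
  sup [set `|h x| | x in [set x : X | `|x| <= 1]].

(* Main.v *)
Require Import Defs.
From HB Require Import structures.
From mathcomp Require Import all_boot all_order all_algebra.
From mathcomp Require Import all_classical all_reals all_analysis.
From mathcomp Require Import ring lra.

Set Implicit Arguments.
Unset Strict Implicit.
Unset Printing Implicit Defensive.

Import Order.TTheory GRing.Theory Num.Theory.
Import numFieldNormedType.Exports.

Local Open Scope classical_set_scope.
Local Open Scope ring_scope.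

(** The Bishop-Phelps argument moves from [x0] to a point that is maximal for a
    cone order, and then separates.

    Order [D] by letting [y] lie above [x] when
    [eps * `|y - x| <= f y - f x].  Going up in this order never decreases [f],
    and it costs distance at most the gain in [f] divided by [eps]; since [f] is
    bounded on [D], increasing sequences are Cauchy, and completeness yields a
    maximal point [x1] above [x0] ([ekeland]).  The gain between [x0] and [x1]
    is less than [delta / 2], which bounds [`|x1 - x0|].

    Maximality of [x1] reads [f (y - x1) <= eps * `|y - x1|] for all [y] in [D].
    So the convex cone of the pairs [(t (y - x1), t f (y - x1))], with [t >= 0]
    and [y] in [D], lies below the graph of the sublinear functional
    [eps * `|x|].  The Hahn-Banach theorem in its sandwich form ([sandwich])
    inserts a linear [h] between them: [h <= eps * `|x|] says that the dual norm
    of [h] is at most [eps], and [f (y - x1) <= h (y - x1)] says that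
    [g = f - h] attains its supremum over [D] at [x1].

    The sandwich theorem rests on one construction, used twice: a sublinear [q]
    above a cone can be lowered to the sublinear functional
    [x |-> inf (q (x + z) - s)], the infimum being over the [(z, s)] in the cone
    ([sublinear_above_cone]).  Every linear minorant of the lowered functional
    dominates the cone.  Applied to the ray through [(x, q x)], the same
    construction shows that a minimal sublinear functional is odd, hence linear;
    Zorn's lemma supplies a minimal one. *)

(** * Infima of sums and of multiples *)

Lemma ler_infD (R : realType) (A B : set R) (m : R) :
  A !=set0 -> B !=set0 -> (forall a b, A a -> B b -> m <= a + b) ->
  m <= inf A + inf B.
Proof.
move=> A0 B0 mAB; rewrite -lerBlDr; apply: lb_le_inf => // a Aa.
rewrite lerBlDr -lerBlDl; apply: lb_le_inf => // b Bb.
by rewrite lerBlDl mAB.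
Qed.

Lemma ler_infM (R : realType) (A : set R) (t m : R) :
  A !=set0 -> 0 <= t -> (forall a, A a -> m <= t * a) -> m <= t * inf A.
Proof.
move=> A0 t0 mA; have [t_eq0|t_neq0] := eqVneq t 0.
  have [a Aa] := A0.
  by rewrite t_eq0 mul0r (le_trans (mA _ Aa))// t_eq0 mul0r.
have {}t0 : 0 < t by rewrite lt0r t_neq0.
rewrite -ler_pdivrMl//; apply: lb_le_inf => // a Aa.
by rewrite ler_pdivrMl// mA.
Qed.

(** * Sublinear functionals and the sandwich theorem *)

(** Positive homogeneity is stated as an inequality, the form in which infima
    preserve it; [sublinearZ] recovers the equality. *)
Definition sublinear (R : realType) (X : lmodType R) (q : X -> R) :=
  (forall x y, q (x + y) <= q x + q y) /\
  (forall t x, 0 <= t -> q (t *: x) <= t * q x).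

Lemma sublinear_oppr_ge (R : realType) (X : lmodType R) (q : X -> R) :
  sublinear q -> forall x, - q (- x) <= q x.
Proof.
move=> [qD qZ] x; have := qD 0 0; have := qD x (- x).
by rewrite subrr addr0; lra.
Qed.

Lemma sublinear0 (R : realType) (X : lmodType R) (q : X -> R) :
  sublinear q -> q 0 = 0.
Proof.
move=> [qD qZ]; have := qZ 0 0 (lexx _); have := qD 0 0.
by rewrite addr0 scale0r mul0r; lra.
Qed.

Lemma sublinearZ (R : realType) (X : lmodType R) (q : X -> R) :
  sublinear q -> forall t x, 0 <= t -> q (t *: x) = t * q x.
Proof.
move=> qsub t x t0; have [_ qZ] := qsub.
have [->|t_neq0] := eqVneq t 0; first by rewrite scale0r mul0r sublinear0.
apply/eqP; rewrite eq_le qZ//= -ler_pdivlMl ?lt0r ?t_neq0//.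
have := qZ t^-1 (t *: x); rewrite scalerA mulVf// scale1r invr_ge0; exact.
Qed.

(** A pointwise infimum of functionals that are sublinear only collectively:
    the index may change when points are added or scaled.  This covers both a
    chain of sublinear functionals, where the smaller of two serves for a sum,
    and the translates of one functional along a cone. *)
Lemma inf_sublinear (R : realType) (X : lmodType R) (T : Type) (I : set T)
    (Q : T -> X -> R) (m : X -> R) :
  I !=set0 ->
  (forall i x, I i -> m x <= Q i x) ->
  (forall i j x y, I i -> I j ->
    exists2 k, I k & Q k (x + y) <= Q i x + Q j y) ->
  (forall i t x, I i -> 0 <= t -> exists2 k, I k & Q k (t *: x) <= t * Q i x) ->
  sublinear (fun x => inf [set Q i x | i in I]) /\
  (forall i x, I i -> inf [set Q i x | i in I] <= Q i x).
Proof.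
move=> [i0 Ii0] mQ QD QZ.
have infQ i x : I i -> inf [set Q i x | i in I] <= Q i x.
  move=> Ii; apply: ge_inf; last by exists i.
  by exists (m x) => _ [j Ij <-]; exact: mQ.
have Q0 x : [set Q i x | i in I] !=set0 by exists (Q i0 x), i0.
split=> //; split=> [x y|t x t0].
- apply: ler_infD => // _ _ [i Ii <-] [j Ij <-].
  have [k Ik] := QD i j x y Ii Ij; apply: le_trans; exact: infQ.
- apply: ler_infM => // _ [i Ii <-].
  have [k Ik] := QZ i t x Ii t0; apply: le_trans; exact: infQ.
Qed.

Definition convex_cone (R : realType) (X : lmodType R) (C : set (X * R)) :=
  [/\ C (0, 0),
      forall x y s r, C (x, s) -> C (y, r) -> C (x + y, s + r)
    & forall t x s, 0 <= t -> C (x, s) -> C (t *: x, t * s)].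

(** Up to closure, the epigraph of [q'] is that of [q] minus the cone.
    The infimum defining [q'] at [x] is finite, because
    [s <= q z <= q (x + z) + q (- x)] for every [(z, s)] in the cone. *)
Lemma sublinear_above_cone (R : realType) (X : lmodType R) (q : X -> R)
    (C : set (X * R)) :
  sublinear q -> convex_cone C -> (forall x s, C (x, s) -> s <= q x) ->
  exists q' : X -> R, [/\ sublinear q', forall x, q' x <= q x
    & forall x s, C (x, s) -> q' (- x) <= - s].
Proof.
move=> [qD qZ] [C0 CD CZ] Cq.
have [|c x|[x1 s1] [x2 s2] x y|[x1 s1] t x|q'sub q'le] :=
  @inf_sublinear _ X (X * R)%type C (fun c x => q (x + c.1) - c.2)
    (fun x => - q (- x)).
- by exists (0, 0).
- case: c => x1 s1 Cxs /=; have := Cq _ _ Cxs; have := qD (x + x1) (- x).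
  by rewrite addrAC subrr add0r; lra.
- move=> /= C1 C2; exists (x1 + x2, s1 + s2) => /=; first exact: CD.
  by have := qD (x + x1) (y + x2); rewrite addrACA; lra.
- move=> /= C1 t0; exists (t *: x1, t * s1) => /=; first exact: CZ.
  by have := qZ t (x + x1) t0; rewrite scalerDr mulrBr; lra.
exists (fun x => inf [set q (x + c.1) - c.2 | c in C]); split=> //.
- by move=> x; have := q'le _ x C0; rewrite /= addr0 subr0.
- move=> x s Cxs; apply: le_trans (q'le _ (- x) Cxs) _ => /=.
  by have := qZ 0 0 (lexx _); rewrite addNr scale0r mul0r; lra.
Qed.

(** Zorn's lemma applies because all sublinear functionals below [p] have the
    common minorant [x |-> - p (- x)], so that the infimum of a chain is
    finite. *)
Lemma exists_minimal_sublinear (R : realType) (X : lmodType R) (p : X -> R) :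
  sublinear p ->
  exists q : X -> R, [/\ sublinear q, forall x, q x <= p x
    & forall q' : X -> R, sublinear q' -> (forall x, q' x <= q x) ->
        forall x, q x <= q' x].
Proof.
move=> psub; have pp x : p x <= p x by [].
pose T := {q : X -> R | sublinear q /\ forall x, q x <= p x}.
pose t0 : T := exist _ p (conj psub pp).
pose S (s t : T) := `[< forall x, sval t x <= sval s x >].
have [|r s t /asboolP rs /asboolP st|A Atot|[q [qsub qp]] qmin] :=
  @ZL_preorder T t0 S.
- by move=> t; apply/asboolP.
- by apply/asboolP => x; exact: le_trans (st x) (rs x).
- have [[a Aa]|A0] := pselect (A !=set0); last first.
    by exists t0 => s As; exfalso; apply: A0; exists s.
  have [|s x|s t x y As At|s t x As t_ge0|qsub qle] :=
    @inf_sublinear _ X T A (fun s => sval s) (fun x => - p (- x)).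
  + by exists a.
  + move=> _; have [ssub sp] := svalP s.
    by have := sublinear_oppr_ge ssub x; have := sp (- x); lra.
  + have [[sD _] [tD _]] := ((svalP s).1, (svalP t).1).
    have [/asboolP st|/asboolP ts] := Atot _ _ As At.
    * by exists t => //; rewrite (le_trans (tD _ _))// lerD2r.
    * by exists s => //; rewrite (le_trans (sD _ _))// lerD2l.
  + by exists s => //; have [_ sZ] := (svalP s).1; exact: sZ.
  have qp x : inf [set sval i x | i in A] <= p x.
    by rewrite (le_trans (qle a x Aa))//; exact: (svalP a).2.
  exists (exist _ (fun x => inf [set sval i x | i in A]) (conj qsub qp)).
  by move=> s As; apply/asboolP => x /=; exact: qle.
exists q; split=> // q' q'sub q'q.
have q'p x : q' x <= p x by exact: le_trans (qp x).
by have /asboolP := qmin (exist _ q' (conj q'sub q'p)) (asboolT q'q).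
Qed.

Lemma ray_convex_cone (R : realType) (X : lmodType R) (x : X) (s : R) :
  convex_cone [set (t *: x, t * s) | t in [set t | 0 <= t]].
Proof.
split; first by exists 0; rewrite /= ?scale0r ?mul0r.
- move=> _ _ _ _ [t t0 [<- <-]] [r r0 [<- <-]]; exists (t + r).
    exact: addr_ge0.
  by rewrite scalerDl mulrDl.
- move=> t _ _ t0 [r r0 [<- <-]]; exists (t * r); first exact: mulr_ge0.
  by rewrite scalerA mulrA.
Qed.

(** Lowering [q] along the ray through [(x, q x)] gives a sublinear functional
    whose value at [- x] is at most [- q x]; by minimality it is [q] itself, so
    [q] is odd.  An odd subadditive functional is additive. *)
Lemma minimal_sublinear_linear (R : realType) (X : lmodType R) (q : X -> R) :
  sublinear q ->
  (forall q' : X -> R, sublinear q' -> (forall x, q' x <= q x) ->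
     forall x, q x <= q' x) ->
  exists h : {linear X -> R^o}, forall x, h x = q x.
Proof.
move=> qsub qmin; have [qD _] := qsub.
have qN x : q (- x) = - q x.
  have [_ _ [t t0 [<- <-]]|q' [q'sub q'q q'x]] :=
    sublinear_above_cone qsub (ray_convex_cone x (q x)).
    by rewrite sublinearZ.
  have /q'x : [set (t *: x, t * q x) | t in [set t : R | 0 <= t]] (x, q x).
    by exists 1; rewrite /= ?scale1r ?mul1r.
  have := qmin _ q'sub q'q (- x); have := sublinear_oppr_ge qsub x.
  lra.
have qDe x y : q (x + y) = q x + q y.
  by have := qD x y; have := qD (x + y) (- y); rewrite addrK qN; lra.
have qlin : linear (q : X -> R^o).
  move=> t x y; rewrite qDe; congr (_ + _).
  have [t0|/ltW t0] := leP 0 t; first by rewrite sublinearZ.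
  rewrite -[t]opprK scaleNr qN sublinearZ ?oppr_ge0//.
  by rewrite -[LHS]mulNr.
pose hL := GRing.isLinear.Build R X R^o *:%R q qlin.
pose h : {linear X -> R^o} := HB.pack (q : X -> R^o) hL.
by exists h.
Qed.

(** The Hahn-Banach theorem: it contains the extension form, with the graph of
    a linear functional on a subspace as the cone. *)
Theorem sandwich (R : realType) (X : lmodType R) (p : X -> R)
    (C : set (X * R)) :
  sublinear p -> convex_cone C -> (forall x s, C (x, s) -> s <= p x) ->
  exists h : {linear X -> R^o},
    (forall x, h x <= p x) /\ (forall x s, C (x, s) -> s <= h x).
Proof.
move=> psub Ccone Cp.
have [p' [p'sub p'p p'C]] := sublinear_above_cone psub Ccone Cp.
have [q [qsub qp' qmin]] := exists_minimal_sublinear p'sub.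
have [h hq] := minimal_sublinear_linear qsub qmin.
exists h; split=> [x|x s Cxs]; first by rewrite hq (le_trans (qp' x)).
by rewrite -lerN2 -linearN hq (le_trans (qp' _))// p'C.
Qed.

(** * Points maximal for the cone order *)

(** Among the points above [x], pick one whose value of [f] is at least halfway
    from [f x] to the supremum. *)
Lemma ekeland_step (R : realType) (X : normedModType R) (D : set X) (f : X -> R)
    (e M : R) (x : X) :
  0 < e -> (forall y, D y -> f y <= M) -> D x ->
  exists y, [/\ D y, e * `|y - x| <= f y - f x
    & forall z, D z -> e * `|z - x| <= f z - f x -> f z <= 2 * f y - f x].
Proof.
move=> e0 fM Dx.
pose S := [set f y | y in [set y | D y /\ e * `|y - x| <= f y - f x]].
have Sx : S (f x) by exists x => //=; rewrite !subrr normr0 mulr0.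
have Ssup : has_sup S.
  by split; [exists (f x) | exists M => _ [y [Dy _] <-]; exact: fM].
(* If the supremum is [f x] then no value exceeds it, and [x] itself serves. *)
have [xS|Sx_le] := ltP (f x) (sup S).
  have [_ [y [Dy xy] <-] Sy] : exists2 r, S r & sup S - (sup S - f x) / 2 < r.
    by apply: sup_adherent => //; lra.
  exists y; split=> // z Dz xz.
  have : f z <= sup S by apply: ub_le_sup; [case: Ssup | exists z].
  lra.
exists x; split=> //; first by rewrite !subrr normr0 mulr0.
move=> z Dz xz; have : f z <= sup S.
  by apply: ub_le_sup; [case: Ssup | exists z].
lra.
Qed.

(** Ekeland's variational principle.  Iterating [ekeland_step] gives an
    increasing sequence [v] converging to some [x1].  A point [y] above [x1] is
    above every [v n], hence [f y <= 2 f (v n.+1) - f (v n)], and the right side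
    tends to [f x1]. *)
Theorem ekeland (R : realType) (X : completeNormedModType R) (D : set X)
    (f : X -> R^o) (e M : R) (x0 : X) :
  0 < e -> closed D -> continuous f -> (forall y, D y -> f y <= M) -> D x0 ->
  exists x1, [/\ D x1, e * `|x1 - x0| <= f x1 - f x0
    & forall y, D y -> f y - f x1 <= e * `|y - x1|].
Proof.
move=> e0 Dcl fcont fM Dx0.
pose above (x y : X) := e * `|y - x| <= f y - f x.
have above_trans x y z : above x y -> above y z -> above x z.
  rewrite /above => xy yz.
  have : e * `|z - x| <= e * (`|z - y| + `|y - x|).
    by rewrite ler_pM2l// -[z - x](subrKA y) ler_normD.
  by rewrite mulrDr; lra.
pose step (x y : {x | D x}) := above (sval x) (sval y) /\
  forall z, D z -> above (sval x) z -> f z <= 2 * f (sval y) - f (sval x).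
have [|u [u0 ustep]] := @dependent_choice _ step _ (exist _ x0 Dx0).
  move=> [x Dx]; apply: cid.
  have [y [Dy xy yz]] := ekeland_step e0 fM Dx.
  by exists (exist _ y Dy).
pose v n := sval (u n).
have v0 : v 0 = x0 by rewrite /v u0.
have Dv n : D (v n) by exact: svalP.
have v_above n m : (n <= m)%N -> above (v n) (v m).
  elim: m => [|m IHm].
    by rewrite leqn0 => /eqP ->; rewrite /above !subrr normr0 mulr0.
  rewrite leq_eqVlt => /predU1P[->|].
    by rewrite /above !subrr normr0 mulr0.
  by rewrite ltnS => /IHm /above_trans; apply; have [] := ustep m.
have fv_homo : {homo (fun n => f (v n)) : n m / (n <= m)%N >-> n <= m}.
  move=> n m nm; rewrite -subr_ge0; apply: le_trans (v_above _ _ nm).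
  exact: mulr_ge0 (ltW e0) (normr_ge0 _).
have fv_cvg : cvgn (fun n => f (v n)).
  by apply: nondecreasing_is_cvgn => //; exists M => _ [n _ <-]; exact: fM.
have fv_le n : f (v n) <= limn (fun n => f (v n)).
  exact: (nondecreasing_cvgn_le fv_homo fv_cvg).
have v_cvg : cvgn v.
  apply/cauchy_cvgP/cauchy_exP => r r0.
  have /cvgrPdist_lt /(_ _ (mulr_gt0 e0 r0)) [N _ lN] := fv_cvg.
  exists (v N); exists N => // n /= Nn.
  rewrite -ball_normE /= distrC -(ltr_pM2l e0).
  apply: le_lt_trans (v_above _ _ Nn) _.
  have := lN N (leqnn N) => /=; apply: le_lt_trans.
  by rewrite ger0_norm ?subr_ge0// lerD2r.
have [x1 vx1] := (cvg_ex (v @ \oo)).1 v_cvg.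
have fvx1 : (fun n => f (v n)) @ \oo --> f x1.
  exact: continuous_cvg (fcont x1) vx1.
have above_x1 n : above (v n) x1.
  have : (fun m => (f (v m) - f (v n)) - e * `|v m - v n|) @ \oo -->
      (f x1 - f (v n)) - e * `|x1 - v n|.
    apply: cvgB; first by apply: cvgB => //; exact: cvg_cst.
    apply: cvgMr; apply: cvg_norm; apply: cvgB => //; exact: cvg_cst.
  rewrite /above -subr_ge0; apply: (closed_cvg _ (@closed_ge R 0)).
  by exists n => // m /= nm; rewrite subr_ge0; exact: v_above.
exists x1; split.
- by apply: (closed_cvg _ Dcl _ _ vx1); exists 0.
- by have := above_x1 0; rewrite /above v0.
move=> y Dy; have [x1y|/ltW//] := leP (e * `|y - x1|) (f y - f x1).
suff : f y <= f x1 by have := mulr_ge0 (ltW e0) (normr_ge0 (y - x1)); lra.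
have fy n : f y <= 2 * f (v n.+1) - f (v n).
  have [_ /(_ _ Dy)] := ustep n; apply.
  exact: above_trans (above_x1 n) x1y.
have : (fun n => 2 * f (v n.+1) - f (v n)) @ \oo --> 2 * f x1 - f x1.
  apply: cvgB => //; apply: cvgMr.
  by move: fvx1; rewrite -(cvg_shiftS (fun n => f (v n))).
have -> : 2 * f x1 - f x1 = f x1 by ring.
apply: (closed_cvg _ (@closed_ge R (f y))); exact: nearW.
Qed.

(** * Linear functionals dominated by a multiple of the norm *)

Lemma norm_sublinear (R : realType) (X : normedModType R) (e : R) :
  0 <= e -> sublinear (fun x : X => e * `|x|).
Proof.
move=> e0; split=> [x y|t x t0].
- by rewrite -mulrDr ler_wpM2l// ler_normD.
- by rewrite normrZ ger0_norm// mulrCA.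
Qed.

Lemma linear_le_norm (R : realType) (X : normedModType R) (e : R)
    (h : {linear X -> R^o}) :
  (forall x, h x <= e * `|x|) -> forall x, `|h x| <= e * `|x|.
Proof.
by move=> hle x; rewrite ler_norml lerNl -linearN -{1}normrN !hle.
Qed.

Lemma linear_le_norm_continuous (R : realType) (X : normedModType R) (e : R)
    (h : {linear X -> R^o}) :
  (forall x, `|h x| <= e * `|x|) -> continuous h.
Proof.
move=> hle; apply: bounded_linear_continuous; apply/linear_boundedP.
near=> r => x; apply: le_trans (hle x) _; rewrite ler_wpM2r//.
Unshelve. all: by end_near. Qed.

Lemma dual_norm_le (R : realType) (X : normedModType R) (e : R)
    (h : {linear X -> R^o}) :
  0 <= e -> (forall x, `|h x| <= e * `|x|) -> dual_norm h <= e.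
Proof.
move=> e0 hle; apply: ge_sup; first by exists `|h 0|, 0; rewrite //= normr0.
by move=> _ [x /= x1 <-]; rewrite (le_trans (hle x))// ler_piMr.
Qed.

Lemma continuous_linear_has_sup (R : realType) (X : normedModType R)
    (D : set X) (f : {linear X -> R^o}) (x0 : X) :
  bounded_set D -> continuous f -> D x0 -> has_sup [set f x | x in D].
Proof.
move=> + fcont Dx0; have Dproper := globally_properfilter Dx0.
move=> /ex_bound [M DM].
split; first by exists (f x0), x0.
have /linear_bounded_continuous/bounded_funP/(_ M) [N fN] := fcont.
exists N => _ [x Dx <-]; apply: le_trans (ler_norm _) _.
by apply: fN; exact: DM.
Qed.

(** * Support points *)

(** The cone spanned by the graph of [f] over [D - x0].  Convexity of [D] gives
    closure under addition: [t (y - x0) + r (z - x0)] is [t + r] times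
    [w - x0], with [w] the barycenter of [y] and [z] of weights [t] and [r]. *)
Lemma convex_set_graph_cone (R : realType) (X : lmodType R) (D : set X) (x0 : X)
    (f : {linear X -> R^o}) :
  convex_set D -> D x0 ->
  convex_cone [set c | exists (t : R) (y : X),
    [/\ 0 <= t, D y & c = (t *: (y - x0), t * f (y - x0))]].
Proof.
move=> Dconv Dx0; split.
- by exists 0, x0; split; rewrite ?scale0r ?mul0r.
- move=> _ _ _ _ [t [y [t0 Dy [-> ->]]]] [r [z [r0 Dz [-> ->]]]].
  have [tr0|tr_neq0] := eqVneq (t + r) 0.
    have [-> ->] : t = 0 /\ r = 0 by lra.
    by exists 0, x0; split=> //; rewrite !scale0r !mul0r !addr0.
  have tr_gt0 : 0 < t + r by rewrite lt0r tr_neq0 addr_ge0.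
  have l0 : 0 <= t / (t + r) by rewrite divr_ge0// ltW.
  have l1 : t / (t + r) <= 1 by rewrite ler_pdivrMr// mul1r lerDl.
  pose w : X := (t / (t + r)) *: y + (1 - t / (t + r)) *: z.
  have Dw : D w.
    have := Dconv y z (Itv01 l0 l1); rewrite !inE; apply => //.
  have wE : (t + r) *: (w - x0) = t *: (y - x0) + r *: (z - x0).
    have -> : w - x0 =
        (t / (t + r)) *: (y - x0) + (1 - t / (t + r)) *: (z - x0).
      rewrite !scalerBr addrACA -opprD -scalerDl.
      by rewrite [_ + (1 - _)]addrC subrK scale1r.
    rewrite scalerDr !scalerA mulrBr mulr1 [_ * (t / _)]mulrC divfK//.
    by rewrite [t + r - t]addrAC subrr add0r.
  exists (t + r), w; split=> //; first exact: ltW.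
  have fZ a u : f (a *: u) = a * f u by rewrite linearZ.
  have fD a b : f (a + b) = f a + f b by rewrite linearD.
  by rewrite -!fZ -fD -wE.
- move=> t _ _ t0 [r [y [r0 Dy [-> ->]]]].
  by exists (t * r), y; split; rewrite ?mulr_ge0 ?scalerA ?mulrA.
Qed.

Theorem theorem2p2 (R : realType) (X : completeNormedModType R) (D : set X)
    (D_bounded : bounded_set D) (D_closed : closed D) (D_convex : convex_set D)
    (eps delta : R) (eps_gt0 : 0 < eps) (delta_gt0 : 0 < delta)
    (f : {linear X -> R^o}) (f_cont : continuous f) (x0 : X) (x0D : D x0)
    (f_x0 : f x0 > sup [set f x | x in D] - delta / 2) :
  exists (g : {linear X -> R^o}) (x1 : X),
    [/\ continuous g, D x1,
        g x1 = sup [set g x | x in D],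
        dual_norm (f \- g) <= eps
      & `|x1 - x0| <= delta / eps].
Proof.
have fD_sup := continuous_linear_has_sup D_bounded f_cont x0D.
have f_le y : D y -> f y <= sup [set f x | x in D].
  by move=> Dy; apply: ub_le_sup; [case: fD_sup | exists y].
have [x1 [Dx1 x01 fx1]] := ekeland eps_gt0 D_closed f_cont f_le x0D.
have [|h [h_le h_ge]] := sandwich (norm_sublinear X (ltW eps_gt0))
  (convex_set_graph_cone f D_convex Dx1).
  move=> _ _ [t [y [t0 Dy [-> ->]]]].
  by rewrite normrZ ger0_norm// mulrCA ler_wpM2l// linearB fx1.
have h_norm := linear_le_norm h_le.
pose g : {linear X -> R^o} := f \- h.
have g_max y : D y -> g y <= g x1.
  move=> Dy; have : f (y - x1) <= h (y - x1).
    by apply: h_ge; exists 1, y; rewrite scale1r mul1r.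
  by rewrite !linearB /g /=; lra.
exists g, x1; split=> //.
- move=> x; apply: cvgB; first exact: f_cont.
  exact: linear_le_norm_continuous h_norm x.
- apply/eqP; rewrite eq_le; apply/andP; split.
    apply: ub_le_sup; last by exists x1.
    by exists (g x1) => _ [y Dy <-]; exact: g_max.
  apply: ge_sup; first by exists (g x1), x1.
  by move=> _ [y Dy <-]; exact: g_max.
- by apply: dual_norm_le (ltW eps_gt0) _ => x; rewrite /= subKr.
- rewrite ler_pdivlMr// mulrC (le_trans x01)//.
  by have := f_le _ Dx1; lra.
Qed.
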